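(* Let $k\ge 2$. The monoids $\mathsf{riAut}(k)$ and $\mathsf{riAut}_{\mathsf{dict}}(k)$ are finitely generated (as monoids).
   Context: Let $A=\{a_1,\dots,a_k\}$ be an alphabet with $k\ge 2$ letters, ordered by $a_1<\dots<a_k$, and $A^*$ the free monoid (all finite words over $A$). A right ideal is a set $R\subseteq A^*$ with $RA^*\subseteq R$; it is essential iff it intersects every (nonempty) right ideal of $A^*$. $\mathsf{riAut}(k)$ is the set of all bijections $\varphi:R_1\to R_2$ between finitely generated essential right ideals $R_1,R_2$ of $A^*$ satisfying $\varphi(xw)=\varphi(x)w$ for all $x\in R_1$, $w\in A^*$; it is a monoid under composition of partial functions. Dictionary order on $A^*$: $u\le_{\mathsf{dict}}v$ if $u$ is a prefix of $v$; if $u,v$ are not prefix-comparable, write $u=pa_ix$, $v=pa_jy$ with $p$ the longest common prefix and $a_i\ne a_j$, and then $u$ and $v$ are ordered as $a_i$ and $a_j$ are. $\mathsf{riAut}_{\mathsf{dict}}(k)$ is the submonoid of those $\varphi\in\mathsf{riAut}(k)$ such that $u\le_{\mathsf{dict}}v$ implies $\varphi(u)\le_{\mathsf{dict}}\varphi(v)$ for all $u,v$ in the domain of $\varphi$. *)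

(* Defs.v *)
From HB Require Import structures.
From mathcomp Require Import all_boot all_order.
From mathcomp Require Import boolp classical_sets.

Set Implicit Arguments.
Unset Strict Implicit.
Unset Printing Implicit Defensive.

Import Order.TTheory.
Local Open Scope classical_set_scope.

(* Words over the ordered alphabet a_1 < ... < a_k: the letter a_i is the
   ordinal of value i - 1. *)
Definition word (k : nat) : Type := seq 'I_k.

(* Partial functions A^* -> A^*; None means undefined. *)
Definition pfun (k : nat) : Type := word k -> option (word k).

HB.instance Definition _ k := Choice.on (pfun k).

Section PfunMonoid.
Variable k : nat.
Implicit Types f g h : pfun k.

Definition pfun_id : pfun k := fun w => Some w.
Definition pfun_comp f g : pfun k := fun w => obind f (g w).

Lemma pfun_compA : associative pfun_comp.
Proof. by move=> f g h; apply/funext => w; rewrite /pfun_comp; case: (h w). Qed.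

Lemma pfun_comp1f : left_id pfun_id pfun_comp.
Proof. by move=> f; apply/funext => w; rewrite /pfun_comp; case: (f w). Qed.

Lemma pfun_compf1 : right_id pfun_id pfun_comp.
Proof. by []. Qed.

HB.instance Definition _ :=
  isMonoid.Build (pfun k) pfun_compA pfun_comp1f pfun_compf1.

Definition dom f : set (word k) := [set u | exists v, f u = Some v].
Definition im f : set (word k) := [set v | exists u, f u = Some v].

End PfunMonoid.

Section RiAut.
Variable k : nat.
Implicit Types (R : set (word k)) (f : pfun k) (u v w x y : word k).

Definition right_ideal R := forall x w, R x -> R (x ++ w).

Definition ideal_gen (C : seq (word k)) : set (word k) :=
  [set u | exists2 x, x \in C & exists w, u = x ++ w].

Definition fg_right_ideal R := exists C : seq (word k), R = ideal_gen C.

Definition essential R :=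
  forall R', right_ideal R' -> R' !=set0 -> R `&` R' !=set0.

Definition fg_essential_right_ideal R :=
  [/\ right_ideal R, fg_right_ideal R & essential R].

(* f is a surjection from dom f onto im f by definition, so that only
   injectivity is required for it to be a bijection R1 -> R2 with
   R1 = dom f and R2 = im f. *)
Definition riAut : set (pfun k) :=
  [set f | [/\ fg_essential_right_ideal (dom f),
               fg_essential_right_ideal (im f),
               (forall u v y, f u = Some y -> f v = Some y -> u = v) &
               (forall x y w, f x = Some y -> f (x ++ w) = Some (y ++ w))]].

(* When u and v are not prefix-comparable, the decomposition below is unique
   and p is their longest common prefix. *)
Definition dict_le u v :=
  prefix u v \/
  exists (p x y : word k) (a b : 'I_k),
    [/\ u = p ++ a :: x, v = p ++ b :: y & (a < b)%N].

Definition riAut_dict : set (pfun k) :=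
  riAut `&` [set f | forall u v u' v', f u = Some u' -> f v = Some v' ->
                     dict_le u v -> dict_le u' v'].

(* dict_le is the lexicographic order of the library. *)
Lemma dict_leE u v : dict_le u v <-> (u <= v :> Order.SeqLexiOrder.type_ 'I_k)%O.
Proof.
split.
  case=> [/prefixP[w ->]|[p [x [y [a [b [-> -> ab]]]]]]].
    by elim: u => [|c u IH] //; rewrite cat_cons lexi_cons lexx.
  elim: p => [|c p IH]; rewrite ?cat_cons ?cat0s lexi_cons.
    by rewrite !leEord (ltnW ab) leqNgt ab.
  by rewrite lexx.
elim: u v => [|c u IH] [|d v] //; try by left.
rewrite lexi_cons => /andP[cd +].
have [->|cNd] := eqVneq c d; last first.
  move=> _; right; exists [::], u, v, c, d; split=> //.
  by rewrite ltn_neqAle (inj_eq val_inj) cNd.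
rewrite lexx /= => /IH[/prefixP[w ->]|[p [x [y [a [b [-> -> ab]]]]]]].
  by left; apply/prefixP; exists w.
by right; exists (d :: p), x, y, a, b.
Qed.

End RiAut.

(* The subset S of M is a submonoid generated by a finite set: it consists
   exactly of the products of the words over gens (the empty product being 1);
   in particular gens is included in S. *)
Definition fg_submonoid (M : monoidType) (S : set M) :=
  exists gens : seq M,
    S = [set f | exists2 s : seq M,
                   {subset s <= gens} & f = (\prod_(g <- s) g)%g].

(* Main.v *)
(* An element of riAut(k) is a table: a bijection between the leaves of two
   k-ary trees with the same number [m] of inner vertices (carets); it lies in
   riAut_dict(k) iff it respects the left-to-right order of the leaves.  By
   induction on [m], the tables with at most 10 carets generate.  A table that
   maps some bottom caret of its domain tree onto a bottom caret of its range
   tree is a smaller table composed with the identity of the domain tree.  For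
   large [m], an order-preserving table P -> Q factors as P -> T -> U -> Q,
   where each factor is of this kind, because there is room for a bottom caret
   in T and U that avoids the chosen bottom carets of P and Q.  The identity of
   a tree with two bottom carets is the product of the identities of the two
   trees obtained by removing one of them, and the other identities are
   conjugate to these by smaller tables.  Permutations of the leaves reduce to
   adjacent transpositions, performed on a tree with a bottom caret that they
   do not meet. *)
Require Import Defs.
From mathcomp Require Import all_boot.
From mathcomp Require Import boolp classical_sets.
From mathcomp Require Import zify.

Set Implicit Arguments.
Unset Strict Implicit.
Unset Printing Implicit Defensive.

(** * The dictionary order on incomparable words, and prefix codes *)

Section BranchOrder.
Variable k : nat.
Implicit Types (u v w x y p : word k) (P Q : seq (word k)).

(** The dictionary order without its prefix case: the words must part at some letter. Hence it
    survives extending both words on the right, which [dict_le] does not. *)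
Fixpoint branch_lt (u v : word k) : bool :=
  match u, v with
  | a :: u', b :: v' => (a < b) || (a == b) && branch_lt u' v'
  | _, _ => false
  end.

Lemma branch_lt_irr : irreflexive branch_lt.
Proof. by elim=> //= a u ->; rewrite ltnn eqxx. Qed.

Lemma branch_lt_catl p u v : branch_lt (p ++ u) (p ++ v) = branch_lt u v.
Proof. by elim: p => //= a p ->; rewrite ltnn eqxx. Qed.

Lemma branch_lt_catr u v x y : branch_lt u v -> branch_lt (u ++ x) (v ++ y).
Proof.
elim: u v => // a u IH [|b v] //= /orP[->//|/andP[/eqP-> /IH->]].
by rewrite eqxx orbT.
Qed.

Lemma branch_lt_asym u v : branch_lt u v -> branch_lt v u = false.
Proof.
elim: u v => // a u IH [|b v] //= /orP[ab|/andP[/eqP-> /IH->]].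
  have -> : (b == a) = false by apply/negbTE; move: ab; rewrite -val_eqE /=;
    lia.
  by lia.
by rewrite ltnn eqxx.
Qed.

Lemma prefix_branch_lt u v :
  prefix u v -> (branch_lt u v = false) * (branch_lt v u = false).
Proof.
case/prefixP=> w ->.
by split; elim: u => [|a u IH] //=; rewrite ?ltnn ?eqxx ?IH //; case: w.
Qed.

Lemma branch_lt_prefix u v :
  branch_lt u v -> (prefix u v = false) * (prefix v u = false).
Proof.
move=> uv; split; apply/negP => /prefix_branch_lt[]; by rewrite uv.
Qed.

Lemma dict_leP u v : dict_le u v <-> prefix u v || branch_lt u v.
Proof.
split.
  case=> [->//|[p [x [y [a [b [-> -> ab]]]]]]].
  by rewrite branch_lt_catl /= ab orbT.
case/orP=> [|uv]; first by left.
right; elim: u v uv => [|c u IH] [|d v] //=; case/orP=> [cd|].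
  by exists [::], u, v, c, d.
case/andP=> /eqP<- /IH[p [x [y [a [b [-> -> ab]]]]]].
by exists (c :: p), x, y, a, b.
Qed.

Definition prefix_code P :=
  uniq P /\ {in P &, forall x y, prefix x y -> x = y}.

Lemma prefix_code_perm P Q : perm_eq P Q -> prefix_code P -> prefix_code Q.
Proof.
move=> PQ [uP fP]; split; first by rewrite -(perm_uniq PQ).
by move=> x y; rewrite -!(perm_mem PQ); apply: fP.
Qed.

Lemma pairwise_branch_lt_code P : pairwise branch_lt P -> prefix_code P.
Proof.
move=> sP; split; first exact: pairwise_uniq branch_lt_irr sP.
elim: P sP => // z P IH; rewrite pairwise_cons => /andP[/allP zP /IH{}IH] x y.
rewrite !inE => /predU1P[->|xP] /predU1P[->|yP] //; last exact: IH.
  by rewrite (branch_lt_prefix (zP _ yP)).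
by rewrite (branch_lt_prefix (zP _ xP)).
Qed.

Lemma prefix_comparable u v w :
  prefix u w -> prefix v w -> prefix u v || prefix v u.
Proof.
elim: u v w => [|a u IH] [|b v] [|c w] //=; rewrite ?orbT //.
by case/andP=> /eqP-> uw /andP[/eqP-> vw]; rewrite eqxx /=; apply: IH uw vw.
Qed.

Lemma prefix_code_cat P x y v w : prefix_code P -> x \in P -> y \in P ->
  x ++ v = y ++ w -> x = y /\ v = w.
Proof.
move=> [_ fP] xP yP xy.
have /orP[/fP|/fP] : prefix x y || prefix y x.
    apply: (prefix_comparable (prefix_prefix x v)).
    by rewrite xy prefix_prefix.
  move=> /(_ xP yP) exy; split=> //; move: xy; rewrite exy => /eqP.
  by rewrite eqseq_cat // eqxx => /eqP.
move=> /(_ yP xP) exy; split=> //; move: xy; rewrite exy => /eqP.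
by rewrite eqseq_cat // eqxx => /eqP.
Qed.

End BranchOrder.

(** * Partial functions given by tables *)

Section Tables.
Variable k : nat.
Implicit Types (u v w x y p q : word k) (P Q R : seq (word k)).
Implicit Types (t : seq (word k * word k)).

(** A row [(p, q)] sends [p ++ v] to [q ++ v]. The first matching row wins, a choice without effect
    once the first column is a prefix code. *)
Fixpoint tab t : pfun k := fun w =>
  if t is (p, q) :: t' then
    if prefix p w then Some (q ++ drop (size p) w) else tab t' w
  else None.

Lemma tab_Some t w y : tab t w = Some y ->
  exists p q v, [/\ (p, q) \in t, w = p ++ v & y = q ++ v].
Proof.
elim: t => // -[p q] t IH /=; case: ifP => [/prefixP[v ->]|_].
  rewrite drop_size_cat // => -[<-]; exists p, q, v; by rewrite mem_head.
by move=> /IH[p' [q' [v [tP -> ->]]]]; exists p', q', v; rewrite inE tP orbT.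
Qed.

Lemma tab_mem t p q v :
  prefix_code (unzip1 t) -> (p, q) \in t -> tab t (p ++ v) = Some (q ++ v).
Proof.
move=> ct pq; elim: t ct pq => // -[p' q'] t IH [/= /andP[p't ut] ft].
rewrite inE => /predU1P[[-> ->]|pqt].
  by rewrite prefix_prefix drop_size_cat.
have pt : p \in unzip1 t by apply/mapP; exists (p, q).
case: ifP => [p'p|_]; last first.
  apply: IH => //; split=> // x y xt yt; apply: ft; by rewrite inE ?xt ?yt orbT.
have /orP[/ft|/ft] := prefix_comparable p'p (prefix_prefix p v).
  by rewrite !inE eqxx pt orbT => /(_ isT isT) E; rewrite E pt in p't.
by rewrite !inE eqxx pt orbT => /(_ isT isT) E; rewrite -E pt in p't.
Qed.

Definition covers P w := has (fun p : word k => prefix p w) P.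

Lemma tab_None t w : tab t w = None <-> ~~ covers (unzip1 t) w.
Proof. by elim: t => // -[p q] t IH /=; case: ifP. Qed.

Lemma tab_cat t x y w : prefix_code (unzip1 t) ->
  tab t x = Some y -> tab t (x ++ w) = Some (y ++ w).
Proof.
move=> ct /tab_Some[p [q [v [pq -> ->]]]].
by rewrite -!catA; apply: tab_mem.
Qed.

(** The second column being a code fixes [q] and the remainder; its entries being distinct, [q]
    fixes the row. *)
Lemma tab_inj t u v y : prefix_code (unzip2 t) ->
  tab t u = Some y -> tab t v = Some y -> u = v.
Proof.
move=> ct /tab_Some[p [q [x [pq -> ->]]]] /tab_Some[p' [q' [x' [pq' -> E]]]].
have qt : q \in unzip2 t by apply/mapP; exists (p, q).
have qt' : q' \in unzip2 t by apply/mapP; exists (p', q').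
have [E1 ->] := prefix_code_cat ct qt qt' E; congr (_ ++ _).
have [ut _] := ct; move: pq pq' ut; rewrite -E1.
elim: t {ct qt qt' E} => // -[a b] t IH; rewrite !inE /= !xpair_eqE.
move=> + + /andP[bt ut].
case/orP=> [/andP[/eqP-> /eqP E2]|pt];
  case/orP=> [/andP[/eqP-> /eqP E3]|pt'] //.
- by case/negP: bt; apply/mapP; exists (p', q).
- by case/negP: bt; apply/mapP; exists (p, q).
- exact: IH.
Qed.

Lemma eq_tab t t' : prefix_code (unzip1 t) -> t =i t' -> uniq (unzip1 t') ->
  tab t = tab t'.
Proof.
move=> ct tt' ut'.
have e1 : unzip1 t =i unzip1 t' by apply: eq_mem_map.
have ct' : prefix_code (unzip1 t').
  by split=> // x y; rewrite -!e1; case: ct => _; apply.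
apply/funext => w; case E : (tab t w) => [y|].
  have [p [q [v [pq -> ->]]]] := tab_Some E.
  by apply/esym/tab_mem; rewrite -?tt'.
by apply/esym/tab_None; rewrite /covers -(eq_has_r e1); apply/tab_None.
Qed.

Lemma tab_comp t t1 t2 :
  prefix_code (unzip1 t1) -> prefix_code (unzip1 t2) -> unzip1 t = unzip1 t1 ->
  (forall p r, (p, r) \in t -> exists2 q, (p, q) \in t1 & tab t2 q = Some r) ->
  pfun_comp (tab t2) (tab t1) = tab t.
Proof.
move=> c1 c2 e1 H; apply/funext => w; rewrite /pfun_comp.
case E : (tab t w) => [y|].
  have [p [r [v [pr -> ->]]]] := tab_Some E.
  by have [q pq qr] := H _ _ pr; rewrite (tab_mem _ c1 pq) /= (tab_cat _ c2 qr).
suff -> : tab t1 w = None by [].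
by apply/tab_None; rewrite -e1; apply/tab_None.
Qed.

Lemma mem_zip P Q p q : size P = size Q ->
  (p, q) \in zip P Q <->
  exists2 i, i < size P & p = nth [::] P i /\ q = nth [::] Q i.
Proof.
move=> sPQ; split.
  case/(nthP ([::], [::])) => i; rewrite size_zip -sPQ minnn => iP.
  by rewrite nth_zip // => -[<- <-]; exists i.
case=> i iP [-> ->]; rewrite -(nth_zip [::] [::]) //.
by apply: mem_nth; rewrite size_zip -sPQ minnn.
Qed.

Lemma tab_zip_comp P Q R : prefix_code P -> prefix_code Q ->
  size P = size Q -> size R = size Q ->
  pfun_comp (tab (zip Q R)) (tab (zip P Q)) = tab (zip P R).
Proof.
move=> cP cQ sPQ sRQ; apply: tab_comp; rewrite ?unzip1_zip ?sPQ ?sRQ //.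
move=> p r /mem_zip[|i iP [-> ->]]; first by rewrite sPQ sRQ.
exists (nth [::] Q i); first by apply/mem_zip => //; exists i.
rewrite -[nth _ Q i]cats0 -[nth _ R i]cats0; apply: tab_mem.
  by rewrite unzip1_zip ?sRQ.
by apply/mem_zip => //; exists i; rewrite -?sPQ.
Qed.

(** Used with [t] an expansion of [t']: precomposing with the identity on the ideal of [P] cuts [t']
    down to [t]. *)
Lemma tab_restr_l t t' P : prefix_code P -> prefix_code (unzip1 t') ->
  unzip1 t = P -> (forall p q, (p, q) \in t -> tab t' p = Some q) ->
  pfun_comp (tab t') (tab (zip P P)) = tab t.
Proof.
move=> cP ct' tP H; apply: tab_comp; rewrite ?unzip1_zip // => p r pr.
exists p; last exact: H.
have : p \in P by rewrite -tP; apply/mapP; exists (p, r).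
by move=> /(nthP [::])[i iP <-]; apply/mem_zip => //; exists i.
Qed.

(** The mirror image, cutting down the range; the domains are now compared through injectivity of
    [tab t']. *)
Lemma tab_restr_r t t' Q : prefix_code Q -> prefix_code (unzip1 t) ->
  prefix_code (unzip1 t') -> prefix_code (unzip2 t') ->
  unzip2 t = Q -> (forall p q, (p, q) \in t -> tab t' p = Some q) ->
  pfun_comp (tab (zip Q Q)) (tab t') = tab t.
Proof.
move=> cQ ct ct' ct2 tQ H; apply/funext => w; rewrite /pfun_comp.
case E : (tab t w) => [y|].
  have [p [q [v [pq -> ->]]]] := tab_Some E.
  rewrite (tab_cat _ ct' (H _ _ pq)) /=; apply: tab_mem; rewrite ?unzip1_zip //.
  have : q \in Q by rewrite -tQ; apply/mapP; exists (p, q).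
  by move=> /(nthP [::])[i iP <-]; apply/mem_zip => //; exists i.
case E' : (tab t' w) => [y|] //=; case E2 : (tab _ y) => [z|] //.
have [q [q' [v [/mem_zip[//|i iQ [Eq Eq']] Ey _]]]] := tab_Some E2.
have : q \in unzip2 t by rewrite tQ Eq mem_nth.
case/mapP=> -[p r] pr /= Er; rewrite -Er in pr.
(* [t'] takes the same value at [p ++ v] and at [w], so they agree and [t] is defined at [w]. *)
have := tab_cat v ct' (H _ _ pr); rewrite -Ey => /(tab_inj ct2 E') ew.
by have := tab_mem v ct pr; rewrite -ew E.
Qed.

Lemma tab_zip_id P w :
  tab (zip P P) w = if covers P w then Some w else None.
Proof.
case: ifP => [|/negbT]; last by move=> h; apply/tab_None; rewrite unzip1_zip.
elim: P => //= p P IH; case: ifP => // /prefixP[v ->] _.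
by rewrite drop_size_cat.
Qed.

End Tables.

(** * Splitting of sequences, and leaf sequences of trees *)

Lemma seq_split (T : Type) (s : seq T) i : i < size s ->
  exists s1 x s2, s = s1 ++ x :: s2 /\ size s1 = i.
Proof.
elim: s i => // x s IH [|i] /=; first by exists [::], x, s.
by move=> /IH[s1 [y [s2 [-> <-]]]]; exists (x :: s1), y, s2.
Qed.

Lemma seq_split2 (T : Type) (s : seq T) i : i.+1 < size s ->
  exists s1 x y s2, s = s1 ++ x :: y :: s2 /\ size s1 = i.
Proof.
move=> is_; have [s1 [x [s2 [E si]]]] := seq_split (ltnW is_).
move: is_; rewrite E size_cat si; case: s2 E => [|y s2] _ /=; first by lia.
by exists s1, x, y, s2.
Qed.

Section Codes.
Variable k : nat.
Implicit Types (u v w x y p q : word k) (P Q R : seq (word k)).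

Definition sons p : seq (word k) := [seq rcons p a | a <- enum 'I_k].

Definition expand i P :=
  take i P ++ sons (nth [::] P i) ++ drop i.+1 P.

(** The trees with [m] carets, each given by its leaves from left to right, possibly with
    repetitions. Being a finite list, it can index the generators. *)
Fixpoint codes m : seq (seq (word k)) :=
  if m is m'.+1 then [seq expand i P | P <- codes m', i <- iota 0 (size P)]
  else [:: [:: [::]]].

Lemma size_sons p : size (sons p) = k.
Proof. by rewrite size_map size_enum_ord. Qed.

Lemma codesP m P : reflect
  (exists s1 p s2, s1 ++ p :: s2 \in codes m /\ P = s1 ++ sons p ++ s2)
  (P \in codes m.+1).
Proof.
apply: (iffP allpairsPdep) => [[Q [i [Qm]]]|[s1 [p [s2 [Pm ->]]]]].
  rewrite mem_iota /= add0n => iQ ->.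
  exists (take i Q), (nth [::] Q i), (drop i.+1 Q); split=> //.
  by rewrite -drop_nth // cat_take_drop.
exists (s1 ++ p :: s2), (size s1); split=> //.
  by rewrite mem_iota size_cat /= add0n addnS ltnS leq_addr.
rewrite /expand take_size_cat // nth_cat ltnn subnn /=; congr (_ ++ (_ ++ _)).
by rewrite -cat_rcons drop_size_cat // size_rcons.
Qed.

Lemma size_codes m P : 0 < k -> P \in codes m -> size P = (m * k.-1).+1.
Proof.
move=> k0; elim: m P => [|m IH] P; first by rewrite inE => /eqP->.
case/codesP=> s1 [p [s2 [/IH + ->]]].
by rewrite !size_cat size_sons /=; nia.
Qed.

(** The sons of [p] are ordered by their last letter; against the other leaves they inherit the
    position of [p]. *)
Lemma codes_sorted m P : P \in codes m -> pairwise (@branch_lt k) P.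
Proof.
elim: m P => [|m IH] P; first by rewrite inE => /eqP->.
case/codesP=> s1 [p [s2 [/IH + ->]]].
rewrite !pairwise_cat /= !allrel_catr allrel_consr.
case/and4P=> /andP[s1p s12] -> ps2 ->; rewrite s12 /= !andbT.
apply/and3P; split.
- apply/allrelP => x _ xs1 /mapP[a _ ->]; rewrite -[x]cats0 -cats1.
  exact/branch_lt_catr/(allP s1p).
- apply/allrelP => _ x /mapP[a _ ->] xs2; rewrite -[x]cats0 -cats1.
  exact/branch_lt_catr/(allP ps2).
rewrite pairwise_map.
have -> : pairwise (relpre (rcons p) (@branch_lt k)) (enum 'I_k) =
          pairwise (relpre val ltn) (enum 'I_k).
  by apply: eq_pairwise => a b; rewrite /= -!cats1 branch_lt_catl /= andbF orbF.
by rewrite -pairwise_map val_enum_ord -sorted_pairwise ?iota_ltn_sorted //;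
  exact: ltn_trans.
Qed.

Lemma codes_code m P : P \in codes m -> prefix_code P.
Proof. by move/codes_sorted/pairwise_branch_lt_code. Qed.

Lemma codes_size_word m P p : P \in codes m -> p \in P -> size p <= m.
Proof.
elim: m P p => [|m IH] P p.
  by rewrite inE => /eqP->; rewrite inE => /eqP->.
case/codesP=> s1 [q [s2 [qm ->]]]; rewrite !mem_cat => /or3P[ps|ps|ps].
- by apply/leqW/(IH _ _ qm); rewrite mem_cat ps.
- by case/mapP: ps => a _ ->;
    rewrite size_rcons ltnS (IH _ _ qm) // mem_cat mem_head orbT.
- by apply/leqW/(IH _ _ qm); rewrite mem_cat inE ps !orbT.
Qed.

(** Maximality of the code. A word that stops at or above the expanded leaf is a prefix of its first
    son, which exists since [k > 0]. *)
Lemma codes_comparable m P w : 0 < k -> P \in codes m ->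
  exists2 p, p \in P & prefix p w || prefix w p.
Proof.
move=> k0; elim: m P => [|m IH] P.
  by rewrite inE => /eqP->; exists [::]; rewrite ?inE // prefix0s.
case/codesP=> s1 [q [s2 [/IH[p + pw] ->]]].
rewrite mem_cat inE => /or3P[ps|/eqP E|ps].
- by exists p => //; rewrite mem_cat ps.
- subst q; case/orP: pw => [/prefixP[[|a v] ->]|wp].
  + exists (rcons p (Ordinal k0)).
      by rewrite !mem_cat map_f ?orbT // mem_enum.
    by rewrite cats0 prefix_rcons orbT.
  + exists (rcons p a); first by rewrite !mem_cat map_f ?orbT // mem_enum.
    by rewrite -cat_rcons prefix_prefix.
  + exists (rcons p (Ordinal k0)).
      by rewrite !mem_cat map_f ?orbT // mem_enum.
    by rewrite (prefix_trans wp (prefix_rcons _ _)) orbT.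
- by exists p => //; rewrite !mem_cat ps !orbT.
Qed.

Lemma codes_covers m P w : 0 < k -> P \in codes m -> m <= size w -> covers P w.
Proof.
move=> k0 Pm mw; have [p pP /orP[pw|wp]] := codes_comparable w k0 Pm.
  by apply/hasP; exists p.
apply/hasP; exists p => //; have := codes_size_word Pm pP.
(* Here [w] is a prefix of [p] and at least as long, so the two are equal. *)
case/prefixP: wp => -[|a v] E; first by rewrite E cats0 prefix_refl.
by rewrite E size_cat /=; lia.
Qed.

Lemma codes_nonempty m : 0 < k -> exists P, P \in codes m.
Proof.
move=> k0; elim: m => [|m [P Pm]]; first by exists [:: [::]]; rewrite inE.
have := size_codes k0 Pm; case: P Pm => // p P Pm _.
by exists (sons p ++ P); apply/codesP; exists [::], p, P.
Qed.

(** Expanding matched leaves [p] and [q] only restricts the function, as [rcons p a] already goes to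
    [rcons q a]. This feeds [tab_restr_l] and [tab_restr_r]. *)
Lemma tab_expand s1 p s2 t1 q t2 : size s1 = size t1 -> size s2 = size t2 ->
  prefix_code (s1 ++ p :: s2) ->
  forall x y, (x, y) \in zip (s1 ++ sons p ++ s2) (t1 ++ sons q ++ t2) ->
  tab (zip (s1 ++ p :: s2) (t1 ++ q :: t2)) x = Some y.
Proof.
move=> e1 e2 cP x y.
rewrite !zip_cat ?size_sons //=; set t := zip s1 t1 ++ (p, q) :: _.
have tabE x' y' v : (x', y') \in t -> tab t (x' ++ v) = Some (y' ++ v).
  apply: tab_mem; have -> : t = zip (s1 ++ p :: s2) (t1 ++ q ::
    t2) by rewrite /t zip_cat.
  by rewrite unzip1_zip // !size_cat /= e1 e2.
rewrite !mem_cat -[x in tab _ x]cats0 -[y in Some y]cats0.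
case/or3P => [xy|xy|xy].
- by apply: tabE; rewrite mem_cat xy.
- move: xy; rewrite /sons zip_map => /mapP[a _ [-> ->]].
  by rewrite !cats0 -!cats1; apply: tabE; rewrite mem_cat mem_head orbT.
- by apply: tabE; rewrite mem_cat inE xy !orbT.
Qed.

Lemma covers_sons p w : covers (sons p) w -> prefix p w.
Proof.
by case/hasP=> _ /mapP[a _ ->]; apply: prefix_trans (prefix_rcons _ _).
Qed.

(* A word lies below at most one of the two expanded vertices. *)
Lemma tab_id_expand2 s1 p s2 q s3 : prefix_code (s1 ++ p :: s2 ++ q :: s3) ->
  let id_tab P := tab (zip P P) in
  id_tab (s1 ++ sons p ++ s2 ++ sons q ++ s3) =
  pfun_comp (id_tab (s1 ++ sons p ++ s2 ++ q :: s3))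
            (id_tab (s1 ++ p :: s2 ++ sons q ++ s3)).
Proof.
move=> [uP fP] /=; apply/funext => w; rewrite /pfun_comp !tab_zip_id.
have pq : ~~ (prefix p w && prefix q w).
  apply/negP => /andP[pw qw].
  have E : p = q.
    by have /orP[/fP|/fP] := prefix_comparable pw qw;
      rewrite !(mem_cat, inE) ?eqxx ?orbT;
      [apply|move=> /(_ isT isT)].
  move: uP; rewrite E cat_uniq => /and3P[_ _ /= /andP[]].
  by rewrite mem_cat mem_head orbT.
have pw := @covers_sons p w; have qw := @covers_sons q w.
transitivity (if covers (s1 ++ p :: s2 ++ sons q ++ s3) w &&
    covers (s1 ++ sons p ++ s2 ++ q :: s3) w then Some w else None); last first.
  by case: (covers _ w) => //=; rewrite tab_zip_id.
congr (if _ then _ else _); move: pq pw qw; rewrite /covers.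
do ![rewrite has_cat /=].
by case: (has _ s1); case: (has _ s2); case: (has _ s3); case: (prefix p w);
  case: (prefix q w); case: (has _ (sons p)); case: (has _ (sons q)) => //= _;
  do 2?[by move=> /(_ isT)|move=> _].
Qed.

End Codes.

(** * Adjacent transpositions, and generation by tables with few carets *)

Lemma perm_swap_ind (T : eqType) (C : seq T -> Prop) :
  (forall s1 x y s2, C (s1 ++ x :: y :: s2) -> C (s1 ++ y :: x :: s2)) ->
  forall s t, perm_eq s t -> C s -> C t.
Proof.
move=> swapC.
have shift x s1 s2 s3 : C (s1 ++ x :: s2 ++ s3) -> C (s1 ++ s2 ++ x :: s3).
  elim: s2 s1 => //= y s2 IH s1 /swapC.
  by rewrite -cat_rcons => /IH; rewrite cat_rcons.
(* [s1] is a passive left context: the tail is permuted behind the head, then [shift] carries the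
   head to its place. *)
suff H s t s1 : perm_eq s t -> C (s1 ++ s) -> C (s1 ++ t).
  by move=> s t st; apply: (H s t [::] st).
elim: s t s1 => [|x s IH] t s1; first by rewrite perm_sym => /perm_nilP->.
move=> st; have xt : x \in t by rewrite -(perm_mem st) mem_head.
case/splitPr: xt st => t1 t2.
rewrite perm_sym perm_catC /= perm_cons perm_catC perm_sym => st.
by rewrite -cat_rcons => /(IH (t1 ++ t2) _ st); rewrite cat_rcons; apply: shift.
Qed.

Lemma perm_swap_adjacent (T : eqType) (s1 s2 : seq T) x y :
  perm_eq (s1 ++ x :: y :: s2) (s1 ++ y :: x :: s2).
Proof.
by rewrite perm_cat2l -!(cat1s _ (_ :: s2)) -!(cat1s _ s2) perm_catCA.
Qed.

Section Generation.
Variable k : nat.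
Hypothesis k1 : 1 < k.
Implicit Types (p q x y : word k) (P Q R T : seq (word k)).
(** Stands for the submonoid being generated; the aim is that it contains all tables once it
    contains those with at most 10 carets. *)
Variable S : pfun k -> Prop.
Hypothesis S_comp : forall f g, S f -> S g -> S (pfun_comp f g).

Let k0 : 0 < k := ltnW k1.

Let full m := forall P Q, P \in codes k m -> Q \in codes k m ->
  S (tab (zip P Q)).

(** [P] has [m.+1] carets, one of them a bottom caret on the leaves [i] to [i + k - 1]; [m] counts
    the carets left after its removal. *)
Definition caret m i P := exists s1 p s2,
  [/\ size s1 = i, s1 ++ p :: s2 \in codes k m & P = s1 ++ sons p ++ s2].

Lemma caret_codes m i P : caret m i P -> P \in codes k m.+1.
Proof. by case=> s1 [p [s2 [_ Pm ->]]]; apply/codesP; exists s1, p, s2. Qed.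

(** The table matches the two carets; removing both leaves a smaller table, whose restriction by the
    identity of [P] is the given one. *)
Lemma caret_full m i P Q : full m -> caret m i P -> caret m i Q ->
  S (tab (zip P P)) -> S (tab (zip P Q)).
Proof.
move=> Sm cP cQ SP; have PC := codes_code (caret_codes cP).
case: cP SP PC => s1 [p [s2 [si Pm ->]]] SP PC.
case: cQ => t1 [q [t2 [ti Qm ->]]].
have e1 : size s1 = size t1 by rewrite si ti.
have e2 : size s2 = size t2.
  have := size_codes k0 Pm; rewrite -(size_codes k0 Qm) !size_cat /= e1; lia.
rewrite -(@tab_restr_l _ _ (zip (s1 ++ p :: s2) (t1 ++ q ::
  t2)) (s1 ++ sons p ++ s2)) //.
- by apply: S_comp => //; apply: Sm.
- by rewrite unzip1_zip ?size_cat /= ?e1 ?e2 //; apply: codes_code Pm.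
- by rewrite unzip1_zip // !size_cat /= !size_sons e1 e2.
- by apply: tab_expand => //; apply: codes_code Pm.
Qed.

Lemma code_size2 m P Q : P \in codes k m -> Q \in codes k m -> size P = size Q.
Proof. by move=> Pm Qm; rewrite (size_codes k0 Pm) (size_codes k0 Qm). Qed.

Lemma tab_trans m P Q R : P \in codes k m -> Q \in codes k m ->
  R \in codes k m -> S (tab (zip P Q)) -> S (tab (zip Q R)) ->
  S (tab (zip P R)).
Proof.
move=> Pm Qm Rm SPQ SQR.
rewrite -(tab_zip_comp (codes_code Pm) (codes_code Qm));
  rewrite ?(code_size2 Pm Qm) ?(code_size2 Rm Qm) //.
exact: S_comp.
Qed.

(** [T] expands two leaves of an arbitrary tree with [m] carets, so it has [(m.+2 * k.-1).+1]
    leaves; [tab_id_expand2] splits its identity. *)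
Lemma two_carets m i l : i + k <= l -> l + k <= (m.+2 * k.-1).+1 ->
  full m.+1 ->
  exists T, [/\ caret m.+1 i T, caret m.+1 l T & S (tab (zip T T))].
Proof.
move=> il lN Sm; have [T0 T0m] := codes_nonempty m k0.
have sT0 := size_codes k0 T0m.
have [|s1 [p [r [E si]]]] := @seq_split _ T0 i; first by rewrite sT0; nia.
have sr : size r = size T0 - i.+1 by rewrite E size_cat /= si; lia.
(* In [T], [l - i - k] leaves separate the two carets. *)
have [|s2 [q [s3 [Er sl]]]] := @seq_split _ r (l - i - k).
  by rewrite sr sT0; nia.
have Tm : s1 ++ p :: s2 ++ q :: s3 \in codes k m by rewrite -Er -E.
have Tp : s1 ++ sons p ++ s2 ++ q :: s3 \in codes k m.+1.
  by apply/codesP; exists s1, p, (s2 ++ q :: s3).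
have Tq : s1 ++ p :: s2 ++ sons q ++ s3 \in codes k m.+1.
  apply/codesP; exists (s1 ++ p :: s2), q, s3.
  by rewrite -!catA.
exists (s1 ++ sons p ++ s2 ++ sons q ++ s3); split.
- by exists s1, p, (s2 ++ sons q ++ s3).
- exists (s1 ++ sons p ++ s2), q, s3; rewrite -!catA; split=> //.
  by rewrite !size_cat size_sons sl si; lia.
- rewrite tab_id_expand2; last exact: codes_code Tm.
  by apply: S_comp; apply: Sm.
Qed.

Lemma apart_carets m i l : (i + k <= l) || (l + k <= i) ->
  maxn i l + k <= (m.+2 * k.-1).+1 -> full m.+1 ->
  exists T, [/\ caret m.+1 i T, caret m.+1 l T & S (tab (zip T T))].
Proof.
case/orP=> il iN Sm; first by apply: two_carets => //; lia.
by have [|T [? ? ?]] := two_carets il _ Sm; [lia|exists T].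
Qed.

(* Conjugation of [tab (zip T T)] by a smaller table. *)
Lemma caret_id m i P T : full m -> caret m i P -> caret m i T ->
  S (tab (zip T T)) -> S (tab (zip P P)).
Proof.
move=> Sm cP cT ST; have STP := caret_full Sm cT cP ST.
have PC := codes_code (caret_codes cP); have TC := codes_code (caret_codes cT).
have eTP : size P = size T.
  by rewrite (size_codes k0 (caret_codes cP)) (size_codes k0 (caret_codes cT)).
(* [caret_full] would ask for the identity of [P], so the smaller table is cut down on its range
   side, by the identity of [T]. *)
suff SPT : S (tab (zip P T)) by rewrite -(tab_zip_comp PC TC) //; apply: S_comp.
case: cP STP PC eTP => s1 [p [s2 [si Pm ->]]] STP PC eTP.
case: cT ST STP TC eTP => t1 [q [t2 [ti Qm ->]]] ST STP TC eTP.
have e1 : size s1 = size t1 by rewrite si ti.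
have e2 : size s2 = size t2.
  have := size_codes k0 Pm; rewrite -(size_codes k0 Qm) !size_cat /= e1; lia.
rewrite -(@tab_restr_r _ _ (zip (s1 ++ p :: s2) (t1 ++ q ::
  t2)) (t1 ++ sons q ++ t2)) //.
- by apply: S_comp => //; apply: Sm.
- by rewrite unzip1_zip // eTP.
- by rewrite unzip1_zip ?size_cat /= ?e1 ?e2 //; apply: codes_code Pm.
- by rewrite unzip2_zip ?size_cat /= ?e1 ?e2 //; apply: codes_code Qm.
- by rewrite unzip2_zip // eTP.
- by apply: tab_expand => //; apply: codes_code Pm.
Qed.

(** The vertex expanded last carries a bottom caret. *)
Lemma codes_caret m P : P \in codes k m.+1 ->
  exists2 i, i + k <= (m.+1 * k.-1).+1 & caret m i P.
Proof.
case/codesP=> s1 [p [s2 [Pm ->]]]; exists (size s1); last by exists s1, p, s2.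
have := size_codes k0 Pm; rewrite size_cat /=; nia.
Qed.

(* With at least [5 k] leaves, any two blocks of [k] consecutive leaves are
   both disjoint from a third block. *)
Lemma full_step m : 5 * k <= (m.+2 * k.-1).+1 -> full m.+1 -> full m.+2.
Proof.
move=> mk Sm; set N := (_ * _).+1 in mk.
have id_full P : P \in codes k m.+2 -> S (tab (zip P P)).
  case/codes_caret=> i iN cP.
  have [l [il lN]] : exists l,
      (i + k <= l) || (l + k <= i) /\ maxn i l + k <= N.
    (* The last block if it avoids the caret, otherwise the first. *)
    by have [ik|ik] := leqP (i + k) (N - k); [exists (N - k)|exists 0]; lia.
  by have [T [cT _ ST]] := apart_carets il lN Sm; apply: caret_id cT ST.
move=> P Q PN QN.
have [i iN cP] := codes_caret PN; have [j jN cQ] := codes_caret QN.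
have [l [[il jl] [ilN jlN]]] : exists l,
   ((i + k <= l) || (l + k <= i) /\ (j + k <= l) || (l + k <= j)) /\
   (maxn i l + k <= N /\ maxn j l + k <= N).
  (* The first block, the last one, or, when the two carets crowd both ends, the block from [2 * k],
     which is clear of both as [N] is at least [5 * k]. *)
  have [?|?] := leqP k (minn i j); first by exists 0; lia.
  have [?|?] := leqP (maxn i j + k) (N - k); first by exists (N - k); lia.
  by exists (2 * k); lia.
(* [P] and [T] share the caret at [i], [T] and [U] the one at [l], [U] and [Q] the one at [j]. *)
have [T [ciT clT ST]] := apart_carets il ilN Sm.
have [U [cjU clU SU]] := apart_carets jl jlN Sm.
have SPT := caret_full Sm cP ciT (id_full _ PN).
have STU := caret_full Sm clT clU ST.
have SUQ := caret_full Sm cjU cQ SU.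
have SPU := tab_trans PN (caret_codes ciT) (caret_codes cjU) SPT STU.
exact: tab_trans PN (caret_codes cjU) QN SPU SUQ.
Qed.

(** From 11 carets on there are at least [11 * (k - 1) + 1] leaves, which is at least [5 * k] as
    [k >= 2]. *)
Lemma full_all : (forall m, m <= 10 -> full m) -> forall m, full m.
Proof.
move=> S10; elim=> [|m IH]; first exact: S10.
have [?|m10] := leqP m.+1 10; first exact: S10.
by case: m m10 IH => [|m] m10 // IH; apply: full_step => //; nia.
Qed.

Let swaps m := forall s1 x y s2, s1 ++ x :: y :: s2 \in codes k m ->
  S (tab (zip (s1 ++ x :: y :: s2) (s1 ++ y :: x :: s2))).

(** Conjugation by order-preserving tables: swaps at the same position of different trees are
    interchangeable. *)
Lemma swap_transfer m s1 x y s2 t1 x' y' t2 : full m ->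
  s1 ++ x :: y :: s2 \in codes k m -> t1 ++ x' :: y' :: t2 \in codes k m ->
  size s1 = size t1 ->
  S (tab (zip (t1 ++ x' :: y' :: t2) (t1 ++ y' :: x' :: t2))) ->
  S (tab (zip (s1 ++ x :: y :: s2) (s1 ++ y :: x :: s2))).
Proof.
move=> Sm Pm Tm e1 ST.
have e2 : size s2 = size t2.
  by have := code_size2 Pm Tm; rewrite !size_cat e1 /=; lia.
have PC := codes_code Pm; have TC := codes_code Tm.
have pT := perm_swap_adjacent t1 t2 x' y'.
have TC' := prefix_code_perm pT TC.
(* Both columns are exchanged at the same two positions, so this is an order-preserving table with
   its rows reordered. *)
have eT : tab (zip (t1 ++ y' :: x' :: t2) (s1 ++ y :: x :: s2)) =
          tab (zip (t1 ++ x' :: y' :: t2) (s1 ++ x :: y :: s2)).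
  apply: eq_tab; rewrite ?unzip1_zip ?size_cat /= ?e1 ?e2 //; last by case: TC.
  move=> z; rewrite !zip_cat //= !mem_cat !inE; congr (_ || _); exact: orbCA.
rewrite -(@tab_zip_comp _ _ (t1 ++ y' :: x' :: t2)) ?size_cat /= ?e1 ?e2 //.
apply: S_comp; first by rewrite eT; apply: Sm.
rewrite -(@tab_zip_comp _ _ (t1 ++ x' :: y' :: t2)) ?size_cat /= ?e1 ?e2 //.
by apply: S_comp => //; apply: Sm.
Qed.

(** By [swap_transfer] the tree may be chosen with a bottom caret off the swapped pair; the swap is
    then the restriction of a swap with one caret less. *)
Lemma swaps_step m : 5 * k <= (m.+1 * k.-1).+1 -> full m.+1 ->
  swaps m -> swaps m.+1.
Proof.
move=> mk Sm1 Sm s1 x y s2 Pm.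
have sP := size_codes k0 Pm; rewrite size_cat /= in sP.
have [T0 T0m] := codes_nonempty m k0; have sT0 := size_codes k0 T0m.
(* The caret goes just after the pair if [k] leaves fit there, otherwise on the first [k] leaves,
   which then precede the pair. *)
have [i2|i2] := leqP (size s1 + 2 + k) (m.+1 * k.-1).+1.
  have [|t1 [x' [y' [r [E st]]]]] := @seq_split2 _ T0 (size s1); first by nia.
  have sr : size r = size T0 - (size s1).+2 by rewrite E size_cat /= st; lia.
  have [|t2 [p [t3 [Er _]]]] := @seq_split _ r 0; first by rewrite sr; nia.
  subst r T0; set P' := t1 ++ x' :: y' :: t2 ++ sons p ++ t3.
  have P'm : P' \in codes k m.+1.
    apply/codesP; exists (t1 ++ x' :: y' :: t2), p, t3.
    by rewrite /P' -!catA.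
  apply: (@swap_transfer m.+1 _ _ _ _ t1 x' y' (t2 ++ sons p ++ t3)) => //.
  have TC := codes_code T0m; have PC := codes_code P'm.
  have e1 : size (t1 ++ x' :: y' :: t2) = size (t1 ++ y' :: x' :: t2).
    by rewrite !size_cat.
  have H := @tab_expand _ (t1 ++ x' :: y' :: t2) p t3
    (t1 ++ y' :: x' :: t2) p t3 e1 erefl.
  rewrite -!catA /= in H.
  have e : size P' = size (t1 ++ y' :: x' :: t2 ++ sons p ++ t3).
    by rewrite !size_cat.
  rewrite -(@tab_restr_l _ _ (zip (t1 ++ x' :: y' :: t2 ++ p :: t3)
    (t1 ++ y' :: x' :: t2 ++ p :: t3)) P');
    rewrite ?unzip1_zip ?e ?size_cat /= ?size_cat //; last exact: H.
  by apply: S_comp; [apply: Sm|apply: Sm1].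
have [|t1 [p [r [E st]]]] := @seq_split _ T0 0; first by nia.
have sr : size r = size T0 - 1 by rewrite E size_cat /= st; lia.
(* The caret accounts for [k] of the [size s1] leaves before the pair. *)
have [|t2 [x' [y' [t3 [Er st2]]]]] := @seq_split2 _ r (size s1 - k).
  by rewrite sr; nia.
subst r T0; set P' := t1 ++ sons p ++ t2 ++ x' :: y' :: t3.
have P'm : P' \in codes k m.+1.
  by apply/codesP; exists t1, p, (t2 ++ x' :: y' :: t3).
have e' : size s1 = size (t1 ++ sons p ++ t2).
  by rewrite !size_cat size_sons st st2; nia.
have eP : P' = (t1 ++ sons p ++ t2) ++ x' :: y' :: t3 by rewrite -!catA.
apply: (@swap_transfer m.+1 _ _ _ _ (t1 ++ sons p ++ t2) x' y' t3) => //;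
  rewrite -?eP //.
rewrite -!catA.
have TC := codes_code T0m; have PC := codes_code P'm.
have e2 : size (t2 ++ x' :: y' :: t3) = size (t2 ++ y' :: x' :: t3).
  by rewrite !size_cat.
have H := @tab_expand _ t1 p (t2 ++ x' :: y' :: t3) t1 p (t2 ++ y' :: x' :: t3)
  erefl e2.
have e : size P' = size (t1 ++ sons p ++ t2 ++ y' :: x' :: t3).
  by rewrite !size_cat.
rewrite -(@tab_restr_l _ _ (zip (t1 ++ p :: t2 ++ x' :: y' :: t3)
  (t1 ++ p :: t2 ++ y' :: x' :: t3)) P');
  rewrite ?unzip1_zip ?e ?size_cat /= ?size_cat //; last exact: H.
apply: S_comp; last exact: Sm1.
by have := Sm (t1 ++ p :: t2) x' y' t3; rewrite -!catA; apply.
Qed.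

Lemma permuted_full_all :
  (forall m, full m) -> (forall m, m <= 10 -> swaps m) ->
  forall m P Q R, P \in codes k m -> Q \in codes k m -> perm_eq Q R ->
  S (tab (zip P R)).
Proof.
move=> Sm S10 m P Q R Pm Qm QR.
have {S10} swm : forall m', swaps m'.
  elim=> [|m' IH]; first exact: S10.
  have [?|?] := leqP m'.+1 10; first exact: S10.
  by apply: swaps_step => //; nia.
have QC := codes_code Qm.
rewrite -(@tab_zip_comp _ P Q) -?(perm_size QR) ?(code_size2 Pm Qm) //;
  last exact: codes_code Pm.
apply: S_comp; last exact: (Sm _ _ _ Pm Qm).
(* The second column is permuted by adjacent exchanges, the first staying at [Q]. *)
pose C R' := perm_eq Q R' /\ S (tab (zip Q R')).
suff swapC s1 x y s2 : C (s1 ++ x :: y :: s2) -> C (s1 ++ y :: x :: s2).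
  by case: (perm_swap_ind swapC QR (conj (perm_refl Q) (Sm _ _ _ Qm Qm))).
case=> QR' SR.
have pR := perm_swap_adjacent s1 s2 x y.
split; first exact: perm_trans QR' pR.
have sQ := perm_size QR'; rewrite size_cat /= in sQ.
have [|q1 [a [b [q2 [E sq]]]]] := @seq_split2 _ Q (size s1);
  first by rewrite sQ !addnS !ltnS leq_addr.
have e2 : size q2 = size s2 by move/eqP: sQ;
  rewrite E size_cat /= sq eqn_add2l => /eqP[].
subst Q.
have pQ := perm_swap_adjacent q1 q2 a b.
(* The exchange is performed on the side of [Q], whose leaves are in order: swap two leaves of [Q],
   then apply the previous table with two rows exchanged. *)
have eR : tab (zip (q1 ++ b :: a :: q2) (s1 ++ y :: x :: s2)) =
          tab (zip (q1 ++ a :: b :: q2) (s1 ++ x :: y :: s2)).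
  apply: eq_tab; rewrite ?unzip1_zip ?size_cat /= ?sq ?e2 //; last by case: QC.
    exact: prefix_code_perm pQ QC.
  move=> z; rewrite !zip_cat //= !mem_cat !inE; congr (_ || _); exact: orbCA.
rewrite -(@tab_zip_comp _ _ (q1 ++ b :: a :: q2)) ?size_cat /= ?sq ?e2 //;
  last first.
  exact: prefix_code_perm pQ QC.
by apply: S_comp; [rewrite eR|apply: swm Qm].
Qed.

End Generation.

(** * Essential right ideals, and the elements of [riAut] as tables *)

Section Ideals.
Variable k : nat.
Hypothesis k0 : 0 < k.
Implicit Types (u v w x y p q : word k) (P Q : seq (word k)).
Implicit Types (A : set (word k)) (f g : pfun k).

(** For right ideals this is equivalent to being finitely generated and essential, and it is easier
    to carry through compositions. *)
Definition cofinite_length A := exists n, forall w, n <= size w -> A w.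

Lemma ideal_genE P w : ideal_gen P w <-> covers P w.
Proof.
split; first by case=> x xP [v ->]; apply/hasP; exists x;
  rewrite ?prefix_prefix.
by case/hasP=> x xP /prefixP[v ->]; exists x => //; exists v.
Qed.

Lemma fg_essential_cofinite A : fg_essential_right_ideal A -> cofinite_length A.
Proof.
case=> rA [C AC] eA.
have [n nP] : exists n, forall x, x \in C -> size x <= n.
  exists (\max_(x <- C) size x) => x xC; exact: leq_bigmax_seq.
exists n => w nw.
(* Essentiality against the extensions of [w]: some generator is comparable to [w], and [w] is at
   least as long. *)
have [||u [Au [v uv]]] := eA (fun u => exists v, u = w ++ v).
- by move=> x v [v' ->]; exists (v' ++ v); rewrite catA.
- by exists w, [::]; rewrite cats0.
move: Au; rewrite {1}AC uv => -[x xC [v' E]].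
have xw : prefix x w.
  have /orP[//|/prefixP[z xz]] : prefix x w || prefix w x.
    by apply: (@prefix_comparable _ _ _ (w ++ v));
      rewrite ?prefix_prefix // E prefix_prefix.
  have := nP x xC; rewrite xz size_cat.
  by case: z {xz} => [|a z] /=; [rewrite cats0 prefix_refl|lia].
by case/prefixP: xw => z ->; apply: rA; rewrite AC; exists x => //;
  exists [::]; rewrite cats0.
Qed.

(** A tree is grown from the root by expanding leaves outside [A]. No leaf of length [n0] is
    outside, so this stops, and the leaves are then the minimal words of [A]. *)
Lemma cofinite_codes A : right_ideal A -> cofinite_length A ->
  exists m P, P \in codes k m /\ A = ideal_gen P.
Proof.
move=> rA [n0 nA].
pose minimal x := forall u v, x = u ++ v -> v != [::] -> ~ A u.
(* [n] bounds the levels still to grow; [l] is the run of leaves being treated, between [s1] and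
   [s2]. *)
have grow n l s1 s2 m : (forall x, x \in l -> n0 <= n + size x /\ minimal x) ->
    s1 ++ l ++ s2 \in codes k m ->
    exists m' l', s1 ++ l' ++ s2 \in codes k m' /\
                  (forall x, x \in l' -> A x /\ minimal x).
  elim: n l s1 s2 m => [|n IHn] l s1 s2 m lP lm.
    by exists m, l; split=> // x /lP[xn ?]; split=> //; apply: nA.
  elim: l s1 s2 m lP lm => [|p l IHl] s1 s2 m lP lm; first by exists m, [::].
  have [pn pm] := lP p (mem_head _ _).
  have lP' x : x \in l -> n0 <= n.+1 + size x /\ minimal x.
    by move=> xl; apply: lP; rewrite inE xl orbT.
  have [m1 [l1 [l1m l1P]]] : exists m1 l1, s1 ++ l1 ++ l ++ s2 \in codes k m1 /\
                  (forall x, x \in l1 -> A x /\ minimal x).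
    have [pA|pA] := pselect (A p).
      by exists m, [:: p]; split=> // x; rewrite inE => /eqP->.
    apply: (IHn (sons p) _ _ m.+1); last first.
      by apply/codesP; exists s1, p, (l ++ s2).
    move=> _ /mapP[a _ ->]; split; first by rewrite size_rcons; lia.
    (* A proper prefix of a son is [p], which is outside [A], or a proper prefix of [p]. *)
    move=> u v; case/lastP: v => // v b; rewrite -rcons_cat.
    move=> /rcons_inj[E _] _; case: v E => [|c v] E; last exact: pm E _.
    by rewrite cats0 in E; rewrite -E.
  have [|m' [l' [l'm l'P]]] := IHl (s1 ++ l1) s2 m1 lP'.
    by rewrite -catA.
  exists m', (l1 ++ l'); rewrite -!catA; split; first by rewrite catA.
  by move=> x; rewrite mem_cat => /orP[/l1P|/l'P].
have [||m [P [Pm PA]]] := grow n0 [:: [::]] [::] [::] 0.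
- move=> x; rewrite inE => /eqP->; split; first by rewrite addn0.
  by case=> // -[].
- by rewrite inE.
rewrite cats0 /= in Pm; exists m, P; split=> //.
apply/funext => w; apply/propext; split.
  move=> Aw; have [p pP /orP[/prefixP[v ->]|/prefixP[v E]]] :=
    codes_comparable w k0 Pm.
    by exists p => //; exists v.
  exists p => //; exists [::]; rewrite cats0 E.
  case: v E => [|a v] E; first by rewrite cats0.
  by case: ((PA _ pP).2 _ _ E).
by case=> x /PA[Ax _] [v ->]; apply: rA.
Qed.

Lemma fg_essentialP A :
  fg_essential_right_ideal A <-> right_ideal A /\ cofinite_length A.
Proof.
split=> [fA|[rA cA]]; first by split; [case: fA|apply: fg_essential_cofinite].
split=> //.
  by have [m [P [_ ->]]] := cofinite_codes rA cA; exists P.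
move=> B rB [u Bu]; have [n nA] := cA.
(* Padding with [n] letters makes the word long enough for [A]. *)
exists (u ++ nseq n (Ordinal k0)); split; last exact: rB.
by apply: nA; rewrite size_cat size_nseq leq_addl.
Qed.

Lemma riAutP f : riAut f <->
  [/\ cofinite_length (dom f), cofinite_length (im f),
      (forall u v y, f u = Some y -> f v = Some y -> u = v) &
      (forall x y w, f x = Some y -> f (x ++ w) = Some (y ++ w))].
Proof.
split=> [[/fg_essentialP[_ ?] /fg_essentialP[_ ?] ? ?] //|[cd ci injf homf]].
split=> //; apply/fg_essentialP; split=> // x w [y xy].
  by exists (y ++ w); apply: homf.
by exists (y ++ w); apply: homf.
Qed.

Lemma riAut_comp f g : riAut f -> riAut g -> riAut (pfun_comp f g).
Proof.
move=> /riAutP[[nf df] [mf rf] injf homf] /riAutP[[ng dg] [mg rg] injg homg].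
apply/riAutP; split.
- exists (ng + nf) => w nw.
  (* [g] acts on the prefix of length [ng] only; the remaining [nf] letters or more are kept and
     make the value long enough for [f]. *)
  have [|y gy] := dg (take ng w); first by rewrite size_takel; lia.
  have [|z fz] := df (y ++ drop ng w).
    by rewrite size_cat size_drop; lia.
  by exists z; rewrite /pfun_comp -(cat_take_drop ng w) (homg _ _ _ gy).
- exists (mf + mg) => w nw.
  have [|y fy] := rf (take mf w); first by rewrite size_takel; lia.
  have [|x gx] := rg (y ++ drop mf w).
    by rewrite size_cat size_drop; lia.
  by exists x; rewrite /pfun_comp gx /= (homf _ _ _ fy) cat_take_drop.
- move=> u v y; rewrite /pfun_comp; case Eu : (g u) => [u'|] //=.
  case Ev : (g v) => [v'|] //= fu fv.
  by apply: injg Eu _; rewrite Ev (injf _ _ _ fu fv).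
- move=> x y w; rewrite /pfun_comp; case E : (g x) => [x'|] //= fx.
  by rewrite (homg _ _ _ E) /=; apply: homf.
Qed.

Lemma riAut_id : riAut (@pfun_id k).
Proof.
apply/riAutP; split.
- by exists 0 => w _; exists w.
- by exists 0 => w _; exists w.
- by move=> u v y [->] [->].
- by move=> x y w [->].
Qed.

Lemma riAut_dict_comp f g :
  riAut_dict f -> riAut_dict g -> riAut_dict (pfun_comp f g).
Proof.
move=> [rf of_] [rg og]; split; first exact: riAut_comp.
move=> u v u' v'; rewrite /pfun_comp.
case Eu : (g u) => [x|] //= fx; case Ev : (g v) => [y|] //= fy uv.
exact: of_ fx fy (og _ _ _ _ Eu Ev uv).
Qed.

Lemma riAut_dict_id : riAut_dict (@pfun_id k).
Proof. by split; [exact: riAut_id|move=> u v u' v' [<-] [<-]]. Qed.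

Lemma tab_riAut m P Q R : P \in codes k m -> Q \in codes k m -> perm_eq Q R ->
  riAut (tab (zip P R)).
Proof.
move=> Pm Qm QR.
have ePR : size P = size R.
  by rewrite -(perm_size QR) (size_codes k0 Pm) (size_codes k0 Qm).
have cP := codes_code Pm; have cR := prefix_code_perm QR (codes_code Qm).
have tabE p r v : (p, r) \in zip P R -> tab (zip P R) (p ++ v) = Some (r ++ v).
  by apply: tab_mem; rewrite unzip1_zip ?ePR.
apply/riAutP; split.
- exists m => w /(codes_covers k0 Pm)/hasP[p /(nthP [::])[i iP <-]] /prefixP[v
    ->].
  by exists (nth [::] R i ++ v); apply: tabE; apply/mem_zip => //; exists i.
- exists m => w /(codes_covers k0 Qm)/hasP[r]; rewrite (perm_mem QR).
  move=> /(nthP [::])[i iR <-] /prefixP[v ->].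
  exists (nth [::] P i ++ v); apply: tabE; apply/mem_zip => //; exists i => //.
  by rewrite ePR.
- by move=> u v y; apply: tab_inj; rewrite unzip2_zip ?ePR.
- by move=> x y w; apply: tab_cat; rewrite unzip1_zip ?ePR.
Qed.

Lemma dict_le_cat2l p u v : dict_le (p ++ u) (p ++ v) <-> dict_le u v.
Proof.
by rewrite !dict_leP branch_lt_catl prefix_catr // eqxx.
Qed.

(** Compare the rows used: in increasing order the values are ordered, in the same row the common
    prefix cancels, in decreasing order the arguments were not ordered. *)
Lemma tab_riAut_dict m P Q : P \in codes k m -> Q \in codes k m ->
  riAut_dict (tab (zip P Q)).
Proof.
move=> Pm Qm; split; first exact: (tab_riAut Pm Qm (perm_refl _)).
have ePQ : size P = size Q by rewrite (size_codes k0 Pm) (size_codes k0 Qm).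
move=> u v u' v' /tab_Some[p [q [x [/mem_zip[//|i iP [-> ->]] -> ->]]]].
move=> /tab_Some[p' [q' [x' [/mem_zip[//|j jP [-> ->]] -> ->]]]].
have [ij|ji|<-] := ltngtP i j; last by move=> /dict_le_cat2l/dict_le_cat2l;
  apply.
  move=> _; apply/dict_leP/orP; right; apply: branch_lt_catr.
  by apply: (pairwiseP [::] (codes_sorted Qm)) ij; rewrite inE -ePQ.
have lt : branch_lt (nth [::] P j ++ x') (nth [::] P i ++ x).
  by apply: branch_lt_catr; apply: (pairwiseP [::] (codes_sorted Pm)) ji.
by move=> /dict_leP; rewrite (branch_lt_prefix lt) (branch_lt_asym lt).
Qed.

Lemma branch_lt_antisym : antisymmetric (@branch_lt k).
Proof. by move=> u v /andP[uv]; rewrite (branch_lt_asym uv). Qed.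

(** [P] and [Q] are the trees of the domain and the image; [f] maps the leaves of [P] bijectively
    onto those of [Q]. *)
Lemma riAut_tab (hk : 1 < k) f : riAut f -> exists m P Q R,
  [/\ P \in codes k m, Q \in codes k m, perm_eq Q R, f = tab (zip P R) &
      size P = size R].
Proof.
move=> rf; have [[rd _ ed] [ri _ ei] injf homf] := rf.
have [cd ci _ _] := (riAutP f).1 rf.
have [m [P [Pm dP]]] := cofinite_codes rd cd.
have [m' [Q [Qm iQ]]] := cofinite_codes ri ci.
have cP := codes_code Pm; have cQ := codes_code Qm.
have fP p : p \in P -> exists y, f p = Some y.
  move=> pP; have : dom f p by rewrite dP; exists p => //; exists [::];
    rewrite cats0.
  by case=> y; exists y.
pose F p := odflt [::] (f p).
have FE p : p \in P -> f p = Some (F p) by rewrite /F => /fP[y ->].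
have QF : perm_eq Q (map F P).
  apply: uniq_perm; first by case: cQ.
    rewrite map_inj_in_uniq; first by case: cP.
    by move=> p p' /FE fp /FE fp' E; apply: injf fp _; rewrite fp' E.
  have dp x y : f x = Some y -> exists2 p, p \in P & exists v, x = p ++ v.
    by move=> xy; have : dom f x by [exists y]; rewrite dP.
  have iq x y : f x = Some y -> exists2 q, q \in Q & exists v, y = q ++ v.
    by move=> xy; have : im f y by [exists x]; rewrite iQ.
  (* A leaf [q] is the value of some [p ++ v]. As [f p] extends a leaf of [Q], the code property
     forces [v] to be empty. *)
  move=> q; apply/idP/mapP => [qQ|[p pP ->]].
    have : im f q by rewrite iQ; exists q => //; exists [::]; rewrite cats0.
    case=> x xq; have [p pP [v xv]] := dp _ _ xq; exists p => //.
    have [q' q'Q [v' E]] := iq _ _ (FE _ pP).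
    have := homf _ _ v (FE _ pP); rewrite -xv xq => -[E1].
    have [|eq ev] := @prefix_code_cat _ Q q q' [::] (v' ++ v) cQ qQ q'Q.
      by rewrite cats0 E1 E catA.
    by case: v' ev E {E1} => // _; rewrite cats0 eq.
  (* Conversely [f p] extends a leaf [q'], whose preimage is, by injectivity, a prefix of [p] in the
     domain, hence [p] itself. *)
  have [q' q'Q [v E]] := iq _ _ (FE _ pP).
  have : im f q' by rewrite iQ; exists q' => //; exists [::]; rewrite cats0.
  case=> x xq; have := homf _ _ v xq; rewrite -E => xv.
  have [p' p'P [v' E']] := dp _ _ xq.
  have [|ep ev] := @prefix_code_cat _ P p p' [::] (v' ++ v) cP pP p'P.
    by rewrite cats0 (injf _ _ _ (FE _ pP) xv) E' catA.
  by case: v' v ev E {xv E'} => // -[] // _; rewrite cats0 => ->.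
(* Equally many leaves mean equally many carets, as [k > 1]. *)
have em : m = m'.
  have := perm_size QF; rewrite size_map (size_codes k0 Pm) (size_codes k0 Qm).
  by nia.
subst m'; exists m, P, Q, (map F P); rewrite size_map; split=> //.
apply/funext => w; case E : (f w) => [y|].
  have : dom f w by exists y.
  rewrite dP => -[p pP [v Ew]]; move: E;
    rewrite Ew (homf _ _ v (FE _ pP)) => -[<-].
  apply/esym/tab_mem; first by rewrite unzip1_zip ?size_map.
  case/(nthP [::]): pP => i iP <-; apply/mem_zip; first by rewrite size_map.
  by exists i => //; rewrite (nth_map [::]).
apply/esym/tab_None; rewrite unzip1_zip ?size_map //; apply/negP => /ideal_genE.
by rewrite -dP => -[y]; rewrite E.
Qed.

(** The values at the leaves of [P] increase, and two of them in prefix relation would coincide. So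
    [R] is sorted, and the sorted arrangement of [Q] is [Q]. *)
Lemma riAut_dict_tab (hk : 1 < k) f : riAut_dict f -> exists m P Q,
  [/\ P \in codes k m, Q \in codes k m & f = tab (zip P Q)].
Proof.
case=> /(riAut_tab hk)[m [P [Q [R [Pm Qm QR fE ePR]]]]] df.
exists m, P, Q; split=> //; suff -> : Q = R by [].
have cP := codes_code Pm; have cR := prefix_code_perm QR (codes_code Qm).
apply: (pairwise_eq branch_lt_antisym (codes_sorted Qm)) => //.
apply/(pairwiseP [::]) => i j iR jR ij; rewrite !inE in iR jR.
have fP l : l < size R -> f (nth [::] P l) = Some (nth [::] R l).
  move=> lR; rewrite fE -[nth _ P l]cats0 -[nth _ R l]cats0; apply: tab_mem.
    by rewrite unzip1_zip ?ePR.
  by apply/mem_zip => //; exists l; rewrite ?ePR.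
have /dict_leP/orP[pR|//] : dict_le (nth [::] R i) (nth [::] R j).
  apply: (df _ _ _ _ (fP _ iR) (fP _ jR)); apply/dict_leP/orP; right.
  by apply: (pairwiseP [::] (codes_sorted Pm)) ij; rewrite inE ePR.
have [uR /(_ _ _ (mem_nth _ iR) (mem_nth _ jR) pR)/eqP] := cR.
by rewrite nth_uniq // => /eqP E; rewrite E ltnn in ij.
Qed.

End Ideals.

(** * Finite generation *)

Lemma fg_submonoidP (M : monoidType) (S : set M) (gens : seq M) :
  S 1%g -> (forall f g, S f -> S g -> S (f * g)%g) ->
  (forall f, f \in gens -> S f) ->
  (forall (C : M -> Prop), (forall f g, C f -> C g -> C (f * g)%g) ->
     (forall f, f \in gens -> C f) -> forall f, S f -> C f) ->
  fg_submonoid S.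
Proof.
move=> S1 SM gS genS; exists gens; apply/funext => f; apply/propext; split.
  (* The products of words over [gens] form such a class [C]. *)
  apply: (genS (fun f => exists2 s : seq M, {subset s <= gens} &
    f = (\prod_(g <- s) g)%g)) => [g h [s sg ->] [t tg ->]|g gg].
    exists (s ++ t); last by rewrite big_cat.
    by move=> x; rewrite mem_cat => /orP[/sg|/tg].
  by exists [:: g]; [move=> x; rewrite inE => /eqP->|rewrite big_seq1].
case=> s sg ->; rewrite big_seq; elim/big_ind: _ => // g /sg; exact: gS.
Qed.

Theorem theorem3p1 (k : nat) (hk : 2 <= k) :
  fg_submonoid (@riAut k) /\ fg_submonoid (@riAut_dict k).
Proof.
have k0 := ltnW hk; split.
  (* From 0 to 10 carets; the second column is any ordering of the leaves of a tree with as many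
     carets. *)
  pose gens : seq (pfun k) := [seq tab (zip PR.1 PR.2) | m <- iota 0 11,
    PR <- [seq (P, R) | P <- codes k m, R <- flatten [seq permutations Q | Q <-
      codes k m]]].
  apply: (@fg_submonoidP _ _ gens).
  - exact: riAut_id.
  - by move=> f g; apply: riAut_comp.
  - move=> f /allpairsPdep[m [_ [_ /allpairsP[[P R] [Pm /flatten_mapP[Q Qm QR]
      ->]] ->]]].
    by apply: (tab_riAut k0 Pm Qm); move: QR; rewrite mem_permutations perm_sym.
  move=> C CM Cg.
  have C10 m P Q R : m <= 10 -> P \in codes k m -> Q \in codes k m ->
      perm_eq Q R -> C (tab (zip P R)).
    move=> m10 Pm Qm QR; apply/Cg/allpairsPdep; exists m, (P, R); split=> //.
      by rewrite mem_iota; lia.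
    apply/allpairsP; exists (P, R); split=> //=; apply/flatten_mapP;
      exists Q => //.
    by rewrite mem_permutations perm_sym.
  have Cfull : forall m P Q, P \in codes k m -> Q \in codes k m ->
    C (tab (zip P Q)).
    apply: (full_all hk CM) => m m10 P Q Pm Qm.
    exact: C10 m10 Pm Qm (perm_refl _).
  move=> f /(riAut_tab k0 hk)[m [P [Q [R [Pm Qm QR -> _]]]]].
  apply: (permuted_full_all hk CM Cfull _ Pm Qm QR) => m' m10 s1 x y s2 sm.
  exact: (C10 _ _ _ _ m10 sm sm (perm_swap_adjacent _ _ _ _)).
(* As before, with the second column left in dictionary order. *)
pose gens : seq (pfun k) := [seq tab (zip PR.1 PR.2) | m <- iota 0 11,
  PR <- [seq (P, Q) | P <- codes k m, Q <- codes k m]].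
apply: (@fg_submonoidP _ _ gens).
- exact: riAut_dict_id.
- by move=> f g; apply: riAut_dict_comp.
- move=> f /allpairsPdep[m [_ [_ /allpairsP[[P Q] [Pm Qm ->]] ->]]].
  exact: tab_riAut_dict k0 _ _ _ Pm Qm.
move=> C CM Cg f /(riAut_dict_tab k0 hk)[m [P [Q [Pm Qm ->]]]].
apply: (full_all hk CM) Pm Qm => {}m m10 {}P {}Q Pm Qm.
apply/Cg/allpairsPdep; exists m, (P, Q); split=> //.
  by rewrite mem_iota; lia.
by apply/allpairsP; exists (P, Q).
Qed.
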